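(* Let $A\colon\mathcal{D}(A)\subseteq\mathcal{H}\to\mathcal{K}$ be a closed, densely defined linear operator between Hilbert spaces. If $A=UT_\sigma V^*$ is the condensed singular value decomposition of $A$, then the Moore--Penrose inverse of $A$ is $A^\dagger=VT_{\sigma^{-1}}U^*$.
   Context: All Hilbert spaces are separable and complex; $\mathcal{R}$ and $\mathcal{N}$ denote range and kernel, and $P_{\mathcal{X}}$ the orthogonal projection onto a closed subspace $\mathcal{X}$. For measurable $g$ on $(M,\mu)$, $T_g$ is multiplication by $g$ on $L^2_\mu=L^2(M,\mu)$ with domain $\{f\in L^2_\mu:gf\in L^2_\mu\}$; compositions of unbounded operators are taken on their natural domains. A condensed singular value decomposition $A=UT_\sigma V^*$ consists of a $\sigma$-finite Borel measure space $(M,\mu)$, isometries $U\in\mathcal{L}(L^2_\mu,\mathcal{K})$, $V\in\mathcal{L}(L^2_\mu,\mathcal{H})$, and a measurable $\sigma\colon M\to[0,\infty)$ positive almost everywhere such that $\mathcal{D}(A)=\{x\in\mathcal{H}:V^*x\in\mathcal{D}(T_\sigma)\}$ and $Ax=UT_\sigma V^*x$ for all $x\in\mathcal{D}(A)$. The Moore--Penrose inverse $A^\dagger$ of a closed, densely defined $A$ is the unique operator $A^\dagger\colon\mathcal{R}(A)\oplus\mathcal{R}(A)^\perp\subseteq\mathcal{K}\to\mathcal{H}$ (that is, with domain $\mathcal{D}(A^\dagger)=\mathcal{R}(A)\oplus\mathcal{R}(A)^\perp$) satisfying: $\mathcal{R}(A^\dagger)\subseteq\mathcal{D}(A)$; $\mathcal{N}(A^\dagger)=\mathcal{R}(A)^\perp$;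 $AA^\dagger=P_{\overline{\mathcal{R}(A)}}|_{\mathcal{D}(A^\dagger)}$; and $A^\dagger A=P_{\overline{\mathcal{R}(A^\dagger)}}|_{\mathcal{D}(A)}$. *)

(* Defs.v *)
From HB Require Import structures.
From mathcomp Require Import all_boot all_order all_algebra.
From mathcomp Require Import complex.
From mathcomp Require Import all_classical all_reals all_analysis.
From mathcomp Require Import measurable_realfun.

Set Implicit Arguments.
Unset Strict Implicit.
Unset Printing Implicit Defensive.

Import Order.TTheory GRing.Theory Num.Theory.
Import numFieldNormedType.Exports.

Local Open Scope classical_set_scope.
Local Open Scope complex_scope.
Local Open Scope ring_scope.

Section dot_norm.
Context (C : numClosedFieldType) (V : lmodType C) (form : {dot V for Num.conj}).
Implicit Types u v : V.

Let formDl u v w : form (u + v) w = form u w + form v w.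
Proof. exact: linearDl. Qed.
Let formDr u v w : form u (v + w) = form u v + form u w.
Proof. exact: linearDr. Qed.
Let formZl a u v : form (a *: u) v = a * form u v.
Proof. exact: linearZl_LR. Qed.
Let formZr a u v : form u (a *: v) = a^*%R * form u v.
Proof. exact: linearZr_LR. Qed.
Let formC u v : form u v = (form v u)^*%R.
Proof. by rewrite hermC expr0 mul1r. Qed.
Let form_ge0 u : 0 <= form u u.
Proof. exact: dnorm_ge0. Qed.

Lemma dot_Cauchy_Schwarz u v :
  `|form u v| ^+ 2 <= form u u * form v v.
Proof.
have [->|nz_v] := eqVneq v 0.
  by rewrite -(scale0r 0) !formZr rmorph0 !mul0r normr0 expr0n/= mulr0.
have vv0 : form v v != 0 by rewrite gt_eqF// neq0_dnorm_gt0.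
pose a := form u v / form v v; pose w := u - a *: v.
have wv : form w v = 0.
  by rewrite /w -scaleNr formDl formZl mulNr divfK// subrr.
have vw : form v w = 0 by rewrite formC wv rmorph0.
have uE : u = w + a *: v by rewrite subrK.
have -> : form u u = form w w + `|a| ^+ 2 * form v v.
  clearbody a w; rewrite uE formDl !formDr !formZl !formZr wv vw !mulr0 addr0 add0r.
  by rewrite normCK mulrA.
have -> : `|form u v| ^+ 2 = `|a| ^+ 2 * form v v ^+ 2.
  by rewrite -(ger0_norm (form_ge0 v)) -exprMn -normrM divfK.
by rewrite mulrDl [form v v ^+ 2]expr2 mulrA lerDr mulr_ge0.
Qed.

Definition dot_norm u := sqrtC (form u u).

Lemma ler_dot_normD u v : dot_norm (u + v) <= dot_norm u + dot_norm v.
Proof.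
rewrite -ler_sqr ?nnegrE ?addr_ge0 ?sqrtC_ge0 ?dnorm_ge0//.
rewrite sqrrD !sqrtCK formDl !formDr.
have -> : form u u + form u v + (form v u + form v v) =
          form u u + (form u v + form v u) + form v v by rewrite !addrA.
rewrite lerD2r lerD2l.
have -> : form v u = (form u v)^*%R by exact: formC.
have -> : form u v + (form u v)^*%R = 'Re (form u v) *+ 2.
  by rewrite ReE -mulr_natr divfK// pnatr_eq0.
rewrite lerMn2r/=.
apply: (le_trans (leif_Re_Creal _)).
rewrite -ler_sqr ?nnegrE ?mulr_ge0 ?sqrtC_ge0 ?dnorm_ge0//.
by rewrite exprMn !sqrtCK dot_Cauchy_Schwarz.
Qed.

Lemma dot_normZ (a : C) u : dot_norm (a *: u) = `|a| * dot_norm u.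
Proof.
rewrite /dot_norm formZl formZr mulrA -normCK.
by rewrite rootCMl ?exprn_ge0// sqrCK.
Qed.

Lemma dot_norm_eq0 u : dot_norm u = 0 -> u = 0.
Proof.
move=> /eqP; rewrite sqrtC_eq0 => uu0; apply/eqP; apply: contraTT uu0 => u0.
by rewrite gt_eqF// neq0_dnorm_gt0.
Qed.

End dot_norm.

(* [inner] is linear in its first argument and conjugate-linear in the second;
   [R[i]] is ordered by z <= w iff w - z is a nonnegative real. *)
HB.mixin Record isInnerProductSpace (R : realType) H & NormedModule R[i] H := {
  inner : {dot H for (Num.conj : R[i] -> R[i])} ;
  inner_norm : forall x : H, inner x x = `|x| ^+ 2
}.

#[short(type="innerProductSpaceType")]
HB.structure Definition InnerProductSpace (R : realType) :=
  {H of NormedModule R[i] H & isInnerProductSpace R H}.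

#[short(type="hilbertType")]
HB.structure Definition Hilbert (R : realType) :=
  {H of CompleteNormedModule R[i] H & isInnerProductSpace R H}.

Section square_integrable.
Context d (T : measurableType d) (R : realType) (mu : {measure set T -> \bar R}).
Implicit Types f g : T -> R[i].

(* |f|^2 = (Re f)^2 + (Im f)^2; a complex function is measurable when its real
   and imaginary parts are. *)
Definition square_integrable f :=
  [/\ measurable_fun setT (fun x => complex.Re (f x)),
      measurable_fun setT (fun x => complex.Im (f x)) &
      (\int[mu]_x (Normc.normc (f x) ^+ 2)%:E < +oo)%E].

Definition cintegral f : R[i] :=
  (\int[mu]_x complex.Re (f x))%R +i* (\int[mu]_x complex.Im (f x))%R.

Definition L2form f g := cintegral (fun x => f x * (g x)^*%R).

Lemma sqr_normc (z : R[i]) :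
  Normc.normc z ^+ 2 = complex.Re z ^+ 2 + complex.Im z ^+ 2.
Proof. by case: z => a b /=; rewrite sqr_sqrtr// addr_ge0// sqr_ge0. Qed.

Lemma Lfun2P (u : T -> R) : u \in Lfun mu 2%:E <->
  measurable_fun setT u /\ (\int[mu]_x (u x ^+ 2)%:E < +oo)%E.
Proof.
split=> [u2|[mu_ u2]].
  split; first by move: u2 => /andP[]; rewrite inE.
  have /integrableP[_] := Lfun2_integrable_sqr u2.
  apply: le_lt_trans; apply: ge0_le_integral => //.
  - by move=> x _; rewrite lee_fin sqr_ge0.
  - apply/measurable_EFinP/measurable_funX.
    by move: u2 => /andP[]; rewrite inE.
  - apply: measurableT_comp => //; apply/measurable_EFinP/measurable_funX.
    by move: u2 => /andP[]; rewrite inE.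
  - by move=> x _; rewrite /= lee_fin ler_norm.
apply/andP; rewrite !inE; split => //=.
rewrite /finite_norm unlock /Lnorm poweR_lty//.
rewrite (_ : (\int[mu]_x _)%E = (\int[mu]_x (u x ^+ 2)%:E)%E)//.
apply: eq_integral => x _ /=.
by rewrite powR_mulrn// real_normK// num_real.
Qed.

Lemma square_integrableP f : square_integrable f <->
  (fun x => complex.Re (f x)) \in Lfun mu 2%:E /\
  (fun x => complex.Im (f x)) \in Lfun mu 2%:E.
Proof.
split=> [[mRe mIm fi]|[/Lfun2P[mRe Rei] /Lfun2P[mIm Imi]]].
- split; apply/Lfun2P; split => //; apply: le_lt_trans fi;
    (apply: ge0_le_integral => //;
    [by move=> x _; rewrite lee_fin sqr_ge0
    |exact/measurable_EFinP/measurable_funX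
    |under eq_fun do rewrite sqr_normc;
     by apply/measurable_EFinP/measurable_funD; exact: measurable_funX
    |move=> x _; rewrite lee_fin sqr_normc]).
  + by rewrite lerDl sqr_ge0.
  + by rewrite lerDr sqr_ge0.
- split => //; under eq_integral do rewrite sqr_normc EFinD.
  rewrite ge0_integralD//.
  + by rewrite lte_add_pinfty.
  + by move=> x _; rewrite lee_fin sqr_ge0.
  + exact/measurable_EFinP/measurable_funX.
  + by move=> x _; rewrite lee_fin sqr_ge0.
  + exact/measurable_EFinP/measurable_funX.
Qed.

Definition square_integrable_pred : {pred T -> R[i]} :=
  [pred f | `[< square_integrable f >]].

Let Lfun2_comb (a b : R) (u v w : T -> R) :
  u \in Lfun mu 2%:E -> v \in Lfun mu 2%:E -> w \in Lfun mu 2%:E ->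
  (fun x => a * u x + b * v x + w x) \in Lfun mu 2%:E.
Proof.
move=> u2 v2 w2.
have two : (1 <= 2%:E :> \bar R)%E by rewrite lee_fin ler1n.
have [_ cl] := Lfun_submod_closed mu two.
have /(cl b v) := w2 => /(_ v2) h1.
rewrite (_ : (fun _ => _) = a *: u + (b *: v + w)).
  exact: cl.
by apply/funext => x; rewrite -addrA.
Qed.

Lemma square_integrable_submod_closed : submod_closed square_integrable_pred.
Proof.
split.
  apply/asboolP/square_integrableP.
  have two : (1 <= 2%:E :> \bar R)%E by rewrite lee_fin ler1n.
  by have [z _] := Lfun_submod_closed mu two; split; exact: z.
move=> a f g /asboolP/square_integrableP[f1 f2].
move=> /asboolP/square_integrableP[g1 g2].
apply/asboolP/square_integrableP; split.
  rewrite (_ : (fun _ => _) = (fun x => complex.Re a * complex.Re (f x) +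
     (- complex.Im a) * complex.Im (f x) + complex.Re (g x))).
    exact: Lfun2_comb.
  apply/funext => x; rewrite /=.
  change ((a *: f + g) x) with (a * f x + g x).
  by case: a (f x) (g x) => ? ? [? ?] [? ?] /=; rewrite mulNr.
rewrite (_ : (fun _ => _) = (fun x => complex.Re a * complex.Im (f x) +
   complex.Im a * complex.Re (f x) + complex.Im (g x))).
  exact: Lfun2_comb.
apply/funext => x; rewrite /=.
change ((a *: f + g) x) with (a * f x + g x).
by case: a (f x) (g x) => ? ? [? ?] [? ?] /=.
Qed.

HB.instance Definition _ := GRing.isSubmodClosed.Build _ _
  square_integrable_pred square_integrable_submod_closed.

Record L2fun := MkL2fun {
  L2fun_val :> T -> R[i] ;
  _ : L2fun_val \in square_integrable_pred
}.

HB.instance Definition _ := [isSub for L2fun_val].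
HB.instance Definition _ := [Choice of L2fun by <:].
HB.instance Definition _ := [SubChoice_isSubLmodule of L2fun by <:].

Definition null_pred : {pred L2fun} :=
  [pred f : L2fun | `[< {ae mu, forall x, f x = 0} >]].

Lemma null_zmod_closed : zmod_closed null_pred.
Proof.
split; first by apply/asboolP; exact: aeW.
move=> f g /asboolP f0 /asboolP g0; apply/asboolP.
apply: filterS2 f0 g0 => x fx gx.
change ((f - g) x) with (f x - g x).
by rewrite fx gx subrr.
Qed.

HB.instance Definition _ := GRing.isZmodClosed.Build _
  null_pred null_zmod_closed.

End square_integrable.
Arguments null_pred {d T R} mu.

(* Square-integrable functions M -> C modulo functions vanishing almost
   everywhere. The coercion to functions picks a representative. Since [L2] is
   a definition, sums and scalings must be cast, as in [(f + g : L2 mu) x], for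
   the coercion to be found. *)
Definition L2 d (T : measurableType d) (R : realType)
  (mu : {measure set T -> \bar R}) := Quotient.quot (null_pred mu).

Section L2.
Context d (T : measurableType d) (R : realType) (mu : {measure set T -> \bar R}).

Local Open Scope quotient_scope.
Local Notation L2 := (L2 mu).

HB.instance Definition _ := GRing.Zmodule.on L2.
HB.instance Definition _ := Quotient.on L2.

Definition L2_to_fun (f : L2) : T -> R[i] := repr f.
Coercion L2_to_fun : L2 >-> Funclass.

Definition L2pi (f : L2fun mu) : L2 := \pi_L2 f.

Lemma L2piP (f g : L2fun mu) :
  L2pi f = L2pi g <-> {ae mu, forall x, f x = g x}.
Proof.
have -> : (L2pi f = L2pi g) <-> f - g \in null_pred mu.
  rewrite Quotient.idealrBE; split=> [fg|/eqP fg]; last exact: fg.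
  exact/eqP.
split=> [/asboolP|] h.
  by apply: filterS h => x; exact: subr0_eq.
apply/asboolP; apply: filterS h => x fgx.
by change (f x - g x = 0); rewrite fgx subrr.
Qed.

Lemma L2pi_repr (f : L2) : L2pi (repr f) = f.
Proof. exact: reprK. Qed.

Lemma L2piE (f : L2fun mu) : {ae mu, forall x, L2pi f x = f x}.
Proof. by apply/L2piP; rewrite L2pi_repr. Qed.

Lemma L2P (f g : L2) : f = g <-> {ae mu, forall x, f x = g x}.
Proof. by rewrite -{1}[f]L2pi_repr -{1}[g]L2pi_repr; exact: L2piP. Qed.

Lemma L2_square_integrable (f : L2) : square_integrable mu f.
Proof. exact/asboolP/(valP (repr f)). Qed.

Lemma L2piD (f g : L2fun mu) : L2pi (f + g) = L2pi f + L2pi g.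
Proof. exact: (@pi_addr _ _ _ _ _ (Quotient.quot (null_pred mu))). Qed.

Definition L2scale (a : R[i]) (f : L2) : L2 := L2pi (a *: repr f).

Lemma L2piZ a (f : L2fun mu) : L2pi (a *: f) = L2scale a (L2pi f).
Proof.
apply/L2piP; apply: filterS (L2piE f) => x fx.
by change (a * f x = a * L2pi f x); rewrite fx.
Qed.

Let scaleA a b f : L2scale a (L2scale b f) = L2scale (a * b) f.
Proof. by rewrite -[f]L2pi_repr -!L2piZ scalerA. Qed.

Let scale1 : left_id 1 L2scale.
Proof. by move=> f; rewrite -[f]L2pi_repr -!L2piZ scale1r. Qed.

Let scaleDr : right_distributive L2scale +%R.
Proof.
move=> a f g; rewrite -[f]L2pi_repr -[g]L2pi_repr.
by rewrite -!(L2piZ, L2piD) scalerDr.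
Qed.

Let scaleDl f : {morph L2scale^~ f : a b / a + b}.
Proof.
by move=> a b; rewrite -[f]L2pi_repr -!(L2piZ, L2piD) scalerDl.
Qed.

HB.instance Definition _ := GRing.Zmodule_isLmodule.Build R[i] L2
  scaleA scale1 scaleDr scaleDl.

Lemma L2DE (f g : L2) : {ae mu, forall x, (f + g : L2) x = f x + g x}.
Proof.
have -> : f + g = L2pi (repr f + repr g) by rewrite L2piD !L2pi_repr.
exact: L2piE.
Qed.

Lemma L2ZE a (f : L2) : {ae mu, forall x, (a *: f : L2) x = a * f x}.
Proof. exact: L2piE (a *: repr f). Qed.

Let ReE (z w : R[i]) : complex.Re (z * w^*%R) =
  complex.Re z * complex.Re w + complex.Im z * complex.Im w.
Proof. by case: z w => a b [c e] /=; rewrite mulrN opprK. Qed.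

Let ImE (z w : R[i]) : complex.Im (z * w^*%R) =
  complex.Im z * complex.Re w - complex.Re z * complex.Im w.
Proof. by case: z w => a b [c e] /=; rewrite mulrN addrC. Qed.

Let integrable_ReIm (f g : L2) :
  mu.-integrable setT (EFin \o (fun x => complex.Re (f x * (g x)^*%R))) /\
  mu.-integrable setT (EFin \o (fun x => complex.Im (f x * (g x)^*%R))).
Proof.
have /square_integrableP[f1 f2] := L2_square_integrable f.
have /square_integrableP[g1 g2] := L2_square_integrable g.
have I (u v : T -> R) : u \in Lfun mu 2%:E -> v \in Lfun mu 2%:E ->
    mu.-integrable setT (EFin \o (u \* v)).
  by move=> u2 v2; apply/Lfun1_integrable/Lfun2_mul_Lfun1.
split.
  have := integrableD measurableT (I _ _ f1 g1) (I _ _ f2 g2).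
  by apply: eq_integrable => // x _ /=; rewrite ReE.
have := integrableB measurableT (I _ _ f2 g1) (I _ _ f1 g2).
by apply: eq_integrable => // x _ /=; rewrite ImE.
Qed.

Let ae_Rintegral (u v : T -> R) : measurable_fun setT u ->
  measurable_fun setT v -> {ae mu, forall x, u x = v x} ->
  (\int[mu]_x u x = \int[mu]_x v x)%R.
Proof.
move=> mu1 mv uv; congr fine; apply: ae_eq_integral => //.
- exact/measurable_EFinP.
- exact/measurable_EFinP.
- by apply: filterS uv => x -> _.
Qed.

Let L2form_linear (g : L2) a (f h : L2) :
  L2form mu (a *: f + h : L2) g = a * L2form mu f g + L2form mu h g.
Proof.
have [/[dup] iRe /measurable_int/measurable_EFinP mRe
      /[dup] iIm /measurable_int/measurable_EFinP mIm] := integrable_ReIm f g.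
have [/[dup] hRe /measurable_int/measurable_EFinP mhRe
      /[dup] hIm /measurable_int/measurable_EFinP mhIm] := integrable_ReIm h g.
have [/measurable_int/measurable_EFinP msRe
      /measurable_int/measurable_EFinP msIm] := integrable_ReIm (a *: f + h) g.
have E : {ae mu, forall x, (a *: f + h : L2) x * (g x)^*%R =
    a * (f x * (g x)^*%R) + h x * (g x)^*%R}.
  apply: filterS2 (L2DE (a *: f) h) (L2ZE a f) => x -> ->.
  by rewrite mulrDl mulrA.
have cZ (r : R) (u : T -> R) : mu.-integrable setT (EFin \o u) ->
    mu.-integrable setT (EFin \o (fun x => r * u x)).
  by move=> iu; apply: eq_integrable (integrableZl measurableT r iu).
have cD (u v : T -> R) : mu.-integrable setT (EFin \o u) ->
    mu.-integrable setT (EFin \o v) ->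
    mu.-integrable setT (EFin \o (fun x => u x + v x)).
  by move=> iu iv; apply: eq_integrable (integrableD measurableT iu iv).
have comb (p q : R) (u v w s : T -> R) : measurable_fun setT s ->
    mu.-integrable setT (EFin \o u) -> mu.-integrable setT (EFin \o v) ->
    mu.-integrable setT (EFin \o w) ->
    {ae mu, forall x, s x = p * u x + q * v x + w x} ->
    (\int[mu]_x s x = p * \int[mu]_x u x + q * \int[mu]_x v x
                      + \int[mu]_x w x)%R.
  move=> ms iu iv iw sE.
  have ic := cD _ _ (cD _ _ (cZ p _ iu) (cZ q _ iv)) iw.
  rewrite (ae_Rintegral ms _ sE); last first.
    exact/measurable_EFinP/(measurable_int mu ic).
  rewrite RintegralD// ?RintegralD// ?RintegralZl//.
  - exact: cZ.
  - exact: cZ.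
  - by apply: cD; exact: cZ.
rewrite /L2form /cintegral.
rewrite (comb (complex.Re a) (- complex.Im a) _ _ _ _ msRe iRe iIm hRe).
  rewrite (comb (complex.Re a) (complex.Im a) _ _ _ _ msIm iIm iRe hIm).
    by case: (a) => p q /=; rewrite mulNr.
  apply: filterS E => x ->.
  move: (f x * _) (h x * _) => z w.
  by case: (a) z w => ? ? [? ?] [? ?] /=.
apply: filterS E => x ->.
move: (f x * _) (h x * _) => z w.
by case: (a) z w => ? ? [? ?] [? ?] /=; rewrite mulNr.
Qed.

Definition L2dot (f g : L2) : R[i] := L2form mu f g.

Let L2dot_herm (f g : L2) : L2dot f g = (-1) ^+ false * (L2dot g f)^*%R.
Proof.
rewrite expr0 mul1r /L2dot /L2form /cintegral.
have conjE (a b : R) : (a +i* b)^*%R = a -i* b by [].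
rewrite conjE.
congr (_ +i* _).
  apply: eq_Rintegral => x _; rewrite !ReE.
  by rewrite [X in X + _]mulrC [X in _ + X]mulrC.
have [_ gf] := integrable_ReIm g f.
rewrite -mulN1r -RintegralZl//; apply: eq_Rintegral => x _.
by rewrite !ImE mulN1r opprB; congr (_ - _); rewrite mulrC.
Qed.

Let L2dot_linearl (g : L2) : linear_for *%R (L2dot ^~ g).
Proof. by move=> a f h; exact: L2form_linear. Qed.

Let L2dot_linearr (f : L2) :
  linear_for ((Num.conj : R[i] -> R[i]) \; *%R) (L2dot f).
Proof.
move=> a g h; rewrite !(L2dot_herm f) !expr0 !mul1r L2dot_linearl.
by rewrite rmorphD rmorphM.
Qed.

HB.instance Definition _ :=
  bilinear_isBilinear.Build R[i] L2 L2 R[i] *%R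
    ((Num.conj : R[i] -> R[i]) \; *%R) L2dot (L2dot_linearl, L2dot_linearr).

HB.instance Definition _ := isHermitianSesquilinear.Build R[i] L2 false
  (Num.conj : R[i] -> R[i]) L2dot L2dot_herm.

Let L2dot_gt0 (f : L2) : f != 0 -> 0 < L2dot f f.
Proof.
move=> f0; have [iRe iIm] := integrable_ReIm f f.
have mRe := measurable_int _ iRe.
pose u x := complex.Re (f x * (f x)^*%R).
have uE x : u x = complex.Re (f x) ^+ 2 + complex.Im (f x) ^+ 2.
  by rewrite /u ReE -!expr2.
have u0 x : 0 <= u x by rewrite uE addr_ge0// sqr_ge0.
have ImU0 : (\int[mu]_x complex.Im (f x * (f x)^*%R))%R = 0.
  transitivity (\int[mu]_(x in [set: T]) (0 : R))%R.
    by apply: eq_Rintegral => x _; rewrite ImE mulrC subrr.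
  by rewrite /Rintegral integral0.
have intu : (0 <= \int[mu]_x u x)%R by apply: Rintegral_ge0 => x _; exact: u0.
rewrite /L2dot /L2form /cintegral ImU0 ltcE/= eqxx lt_neqAle intu andbT/=.
apply: contra f0 => /eqP/esym intu0; apply/eqP/L2P.
have zE : {ae mu, forall x, (0 : L2) x = 0}.
  by have := L2ZE 0 (0 : L2); apply: filterS => x; rewrite scale0r mul0r.
have : (\int[mu]_x `|(u x)%:E| = 0)%E.
  under eq_integral do rewrite gee0_abs ?lee_fin ?u0//.
  rewrite -(fineK (integrable_fin_num measurableT iRe)).
  by rewrite -[X in X%:E]/(Rintegral _ _ _) intu0.
move/(ae_eq_integral_abs mu measurableT mRe).1.
apply: filterS2 zE => x -> /(_ I) [] /eqP.
rewrite -/(u x) uE paddr_eq0 ?sqr_ge0// !sqrf_eq0 => /andP[/eqP fRe /eqP fIm].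
by apply/eqP; rewrite eq_complex fRe fIm !eqxx.
Qed.

HB.instance Definition _ := isDotProduct.Build R[i] L2 L2dot L2dot_gt0.

HB.instance Definition _ := @Lmodule_isNormed.Build R[i] L2
  (dot_norm L2dot) (ler_dot_normD L2dot) (dot_normZ L2dot) (@dot_norm_eq0 _ _ L2dot).

Let L2dot_norm (f : L2) : L2dot f f = `|f| ^+ 2.
Proof. by rewrite sqrtCK. Qed.

HB.instance Definition _ :=
  @isInnerProductSpace.Build R L2 L2dot L2dot_norm.

End L2.

(* A possibly unbounded operator A : D(A) `<=` H -> K is represented by its
   graph, a set of pairs (x, A x). Composition of operators on their natural
   domains is then composition of relations, [(B \; A)%relation] being the
   operator x |-> B (A x). *)
Section operators.
Context (R : realType) (H K : innerProductSpaceType R).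
Implicit Types A : set (H * K).

Definition dom A : set H := [set x | exists y, A (x, y)].
Definition ran A : set K := [set y | exists x, A (x, y)].
Definition ker A : set H := [set x | A (x, 0)].

Record linear_operator A : Prop := LinearOperator {
  operator_functional : forall x y z, A (x, y) -> A (x, z) -> y = z ;
  operator_zero : A (0, 0) ;
  operator_linear : forall (a : R[i]) x1 y1 x2 y2,
    A (x1, y1) -> A (x2, y2) -> A (a *: x1 + x2, a *: y1 + y2)
}.

Definition graph (f : H -> K) : set (H * K) := [set xy | xy.2 = f xy.1].

(* (y, x) with <A z, y> = <z, x> for all z in D(A): the graph of the adjoint as
   soon as D(A) is dense, in particular when A is everywhere defined. *)
Definition adjoint A : set (K * H) :=
  [set yx | forall z w, A (z, w) -> inner w yx.1 = inner z yx.2].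

Definition orthocomplement (X : set H) : set H :=
  [set x | forall z, X z -> inner x z = 0].

Definition linear_isometry (f : {linear H -> K}) := forall x, `|f x| = `|x|.

End operators.

Definition orthoproj (R : realType) (H : innerProductSpaceType R) (X : set H) :
    set (H * H) :=
  [set xp | X xp.2 /\ orthocomplement X (xp.1 - xp.2)].

Definition restriction (T U : Type) (A : set (T * U)) (D : set T) :
    set (T * U) :=
  A `&` D `*` setT.

Definition separable (T : topologicalType) :=
  exists2 S : set T, countable S & dense S.

(* The domain is {f | g f in L^2}; the second conjunct alone implies the first
   when g is measurable. *)
Definition mul_operator d (T : measurableType d) (R : realType)
    (mu : {measure set T -> \bar R}) (g : T -> R[i]) : set (L2 mu * L2 mu) :=
  [set fh : L2 mu * L2 mu | square_integrable mu (fun x => g x * fh.1 x) /\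
            {ae mu, forall x, fh.2 x = g x * fh.1 x}].
Arguments mul_operator {d T R} mu g.

Notation borelType M := (g_sigma_algebraType (@open M)).

Section condensed_svd.
Context (R : realType) (H K : hilbertType R) (M : ptopologicalType)
  (mu : {sigma_finite_measure set (borelType M) -> \bar R}).

(* U T_s V^* *)
Definition svd_operator (U : {linear L2 mu -> K}) (s : M -> R)
    (V : {linear L2 mu -> H}) : set (H * K) :=
  (graph U \; mul_operator mu (fun x => (s x)%:C) \; adjoint (graph V))%relation.

Record condensed_svd (A : set (H * K)) (U : {linear L2 mu -> K})
    (sigma : M -> R) (V : {linear L2 mu -> H}) : Prop := CondensedSVD {
  svd_left_isometry : linear_isometry U ;
  svd_right_isometry : linear_isometry V ;
  svd_measurable : measurable_fun setT (sigma : borelType M -> R) ;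
  svd_ge0 : forall x, 0 <= sigma x ;
  svd_gt0 : {ae mu, forall x, 0 < sigma x} ;
  svd_dom : dom A = [set x | exists2 f, adjoint (graph V) (x, f) &
                             dom (mul_operator mu (fun x => (sigma x)%:C)) f] ;
  svd_eq : forall x y, A (x, y) -> svd_operator U sigma V (x, y)
}.

End condensed_svd.

(* Characterization only: existence and uniqueness of B are not part of it. *)
Record Moore_Penrose_inverse (R : realType) (H K : hilbertType R)
    (A : set (H * K)) (B : set (K * H)) : Prop := MoorePenroseInverse {
  MP_linear : linear_operator B ;
  MP_dom : dom B = [set y | exists y1 y2,
    [/\ ran A y1, orthocomplement (ran A) y2 & y = y1 + y2]] ;
  MP_ran : ran B `<=` dom A ;
  MP_ker : ker B = orthocomplement (ran A) ;
  MP_mulr : (A \; B)%relation = restriction (orthoproj (closure (ran A))) (dom B) ;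
  MP_mull : (B \; A)%relation = restriction (orthoproj (closure (ran B))) (dom A)
}.

(* Main.v *)
Require Import Defs.
From HB Require Import structures.
From mathcomp Require Import all_boot all_order all_algebra.
From mathcomp Require Import complex.
From mathcomp Require Import all_classical all_reals all_analysis.
From mathcomp Require Import measurable_realfun.
Import Order.TTheory GRing.Theory Num.Theory.
Import numFieldNormedType.Exports.
Local Open Scope classical_set_scope.
Local Open Scope ring_scope.

(* Nothing below uses that L^2 is complete. Truncating z in L^2 to the sets
   {s >= 1/n} shows, by dominated convergence, that T_s has dense range, so
   R(A) is dense in R(U) and R(A)^\perp = N(U^* ). Since U^* U = V^* V = 1 and
   T_{1/s} is the inverse relation of T_s, one gets A A^+ = U U^* on the domain
   of A^+ = V T_{1/s} U^*, which is the projection onto the closure of R(A).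
   The situation is symmetric under exchanging (U, s, V) with (V, 1/s, U),
   which gives A^+ A. Uniqueness: if B and B' are both Moore-Penrose inverses
   of A, then A B = A B', so B y - B' y lies in N(A), but N(A) is orthogonal to
   both R(B) and R(B'). *)

(** * Inner products, closures and orthogonal projections *)

Section inner_product.
Context (R : realType) (H : innerProductSpaceType R).
Implicit Types (x y z : H) (X : set H).

Lemma innerDl x y z : inner (x + y) z = inner x z + inner y z.
Proof. exact: linearDl. Qed.

Lemma innerDr x y z : inner x (y + z) = inner x y + inner x z.
Proof. exact: linearDr. Qed.

Lemma innerBl x y z : inner (x - y) z = inner x z - inner y z.
Proof. exact: linearBl. Qed.

Lemma innerBr x y z : inner x (y - z) = inner x y - inner x z.
Proof. exact: linearBr. Qed.

Lemma innerZl (a : R[i]) x y : inner (a *: x) y = a * inner x y.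
Proof. exact: linearZl_LR. Qed.

Lemma innerZr (a : R[i]) x y : inner x (a *: y) = a^*%R * inner x y.
Proof. exact: linearZr_LR. Qed.

Lemma inner0r x : inner x 0 = 0.
Proof. exact: linear0r. Qed.

Lemma innerC x y : inner x y = (inner y x)^*%R.
Proof. by rewrite hermC expr0 mul1r. Qed.

Lemma inner_eq0 x : inner x x = 0 -> x = 0.
Proof. by rewrite inner_norm => /eqP; rewrite sqrf_eq0 normr_eq0 => /eqP. Qed.

Lemma inner_inj x y : (forall z, inner z x = inner z y) -> x = y.
Proof.
move=> xy; apply/eqP; rewrite -subr_eq0; apply/eqP/inner_eq0.
by rewrite innerBr xy subrr.
Qed.

Lemma inner_Cauchy_Schwarz x y : `|inner x y| <= `|x| * `|y|.
Proof.
rewrite -ler_sqr ?nnegrE ?mulr_ge0// exprMn -!inner_norm.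
exact: dot_Cauchy_Schwarz.
Qed.

Lemma closure_normP X x : closure X x <->
  forall e : R[i], 0 < e -> exists2 z, X z & `|x - z| < e.
Proof.
split=> [Xx e e0|h B /nbhs_ballP[e /= e0 xeB]].
  have [z [Xz]] := Xx _ (nbhsx_ballx x e e0).
  by rewrite -ball_normE; exists z.
have [z Xz xz] := h e e0.
by exists z; split => //; apply: xeB; rewrite -ball_normE.
Qed.

(** Continuity of the inner product: for [z] in [X], [inner x y] equals [inner x (y - z)], which
    Cauchy-Schwarz makes arbitrarily small. *)
Lemma orthocomplement_closure X x :
  orthocomplement X x -> orthocomplement (closure X) x.
Proof.
move=> oX y /closure_normP Xy; apply/eqP; rewrite -normr_le0.
apply/ler_addgt0Pr => e e0; rewrite add0r.
(* Adding 1 keeps the divisor of [e] positive when [x] is 0. *)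
have x1 : 0 < `|x| + 1 by rewrite ltr_wpDl.
have [z Xz yz] := Xy _ (divr_gt0 e0 x1).
rewrite -[y](subrK z) innerDr (oX z Xz) addr0.
apply: (le_trans (inner_Cauchy_Schwarz _ _)).
rewrite ltr_pdivlMr// in yz.
apply: le_trans (ltW yz); rewrite mulrC ler_wpM2l//.
by rewrite lerDl.
Qed.

(** Both [x - p] and [x - q] are orthogonal to [p] and to [q]; their difference is [p - q] up to
    sign, which is thus orthogonal to itself. *)
Lemma orthoproj_uniq X x p q :
  orthoproj X (x, p) -> orthoproj X (x, q) -> p = q.
Proof.
move=> /= [Xp xp] [Xq xq]; apply/eqP; rewrite -subr_eq0; apply/eqP/inner_eq0.
have pqE : p - q = (x - q) - (x - p) by rewrite opprB [RHS]addrC subrKA.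
rewrite {1}pqE innerBl !innerBr.
by rewrite (xq p)// (xq q)// (xp p)// (xp q)// !subrr.
Qed.

End inner_product.

Lemma inner_isometry (R : realType) (H K : innerProductSpaceType R)
    (f : {linear H -> K}) : linear_isometry f ->
  forall x y, inner (f x) (f y) = inner x y.
Proof.
move=> fiso x y.
have ffE u : inner (f u) (f u) = inner u u by rewrite !inner_norm fiso.
(* Polarization: the defect d is linear in u and has zero real part, so taking
   both u and 'i *: u forces d = 0. *)
pose d u v := inner (f u) (f v) - inner u v.
have dE u v : d u v + (d u v)^*%R = 0.
  rewrite /d rmorphB /= -!innerC addrACA -opprD.
  apply/eqP; rewrite subr_eq0; apply/eqP.
  have := ffE (u + v).
  rewrite linearD !innerDl !innerDr !ffE !addrA => /addIr.
  by rewrite -!addrA => /addrI.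
have dZ a u v : d (a *: u) v = a * d u v.
  by rewrite /d linearZ_LR !innerZl mulrBr.
apply/eqP; rewrite -subr_eq0 -/(d x y).
have d1 := dE x y; have d2 := dE ('i *: x) y.
move: d2; rewrite dZ rmorphM /= conjCi mulNr -mulrBr => /eqP.
rewrite mulf_eq0 (negPf (neq0Ci _)) /= subr_eq0 => /eqP d2.
move: d1; rewrite -d2 => /eqP.
by rewrite -mulr2n mulrn_eq0.
Qed.

(** * Multiplication by real functions on $L^2$ *)

Section multiplication_operator.
Context d (T : measurableType d) (R : realType) (mu : {measure set T -> \bar R}).
Implicit Types (f h z : L2 mu) (g s : T -> R).

Lemma Re_realM (a : R) (w : R[i]) : complex.Re (a%:C%C * w) = a * complex.Re w.
Proof. by case: w => x y /=; rewrite mul0r subr0. Qed.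

Lemma Im_realM (a : R) (w : R[i]) : complex.Im (a%:C%C * w) = a * complex.Im w.
Proof. by case: w => x y /=; rewrite mul0r addr0. Qed.

Lemma normc_realM (a : R) (w : R[i]) :
  Normc.normc (a%:C%C * w) ^+ 2 = a ^+ 2 * Normc.normc w ^+ 2.
Proof. by rewrite !Defs.sqr_normc Re_realM Im_realM !exprMn mulrDr. Qed.

Lemma normc2_ge0 (w : R[i]) : 0 <= Normc.normc w ^+ 2.
Proof. by rewrite Defs.sqr_normc addr_ge0// sqr_ge0. Qed.

Lemma measurable_normc2 (u : T -> R[i]) :
  measurable_fun setT (fun x => complex.Re (u x)) ->
  measurable_fun setT (fun x => complex.Im (u x)) ->
  measurable_fun setT (fun x => (Normc.normc (u x) ^+ 2)%:E).
Proof.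
move=> mRe mIm; under eq_fun do rewrite Defs.sqr_normc.
by apply/measurable_EFinP/measurable_funD; exact: measurable_funX.
Qed.

Lemma measurable_realM g (u : T -> R[i]) : measurable_fun setT g ->
  measurable_fun setT (fun x => complex.Re (u x)) ->
  measurable_fun setT (fun x => complex.Im (u x)) ->
  measurable_fun setT (fun x => complex.Re ((g x)%:C%C * u x)) /\
  measurable_fun setT (fun x => complex.Im ((g x)%:C%C * u x)).
Proof.
move=> mg mRe mIm; split.
  by under eq_fun do rewrite Re_realM; exact: measurable_funM.
by under eq_fun do rewrite Im_realM; exact: measurable_funM.
Qed.

Lemma square_integrable_rep (u : T -> R[i]) : square_integrable mu u ->
  exists f, {ae mu, forall x, f x = u x}.
Proof.
move=> /asboolP u2; exists (L2pi (MkL2fun u2)); exact: L2piE.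
Qed.

Lemma bounded_mul_rep g (c : R) z : measurable_fun setT g ->
  (forall x, g x ^+ 2 <= c) ->
  exists h, {ae mu, forall x, h x = (g x)%:C%C * z x}.
Proof.
move=> mg gc; apply: square_integrable_rep.
have [mRe mIm z2] := L2_square_integrable z.
have [mgRe mgIm] := measurable_realM _ _ mg mRe mIm.
(* On an empty [T] the bound [c] may be negative, and all integrals vanish; otherwise a point of [T]
   gives [0 <= c]. *)
have [x0|] := pselect (T -> False).
  split => //; rewrite (_ : (\int[mu]_x _)%E = 0%E)//.
  by apply: integral0_eq => x _; case: (x0 x).
move=> /existsNP[x0 _].
have c0 : 0 <= c by apply: le_trans (gc x0); rewrite sqr_ge0.
split => //.
apply: (@le_lt_trans _ _ (c%:E * \int[mu]_x (Normc.normc (z x) ^+ 2)%:E)%E).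
  rewrite -ge0_integralZl//; last 2 first.
  - exact: measurable_normc2.
  - by move=> x _; rewrite lee_fin normc2_ge0.
  apply: ge0_le_integral => //.
  - by move=> x _; rewrite lee_fin normc2_ge0.
  - exact: measurable_normc2.
  - exact/measurable_funeM/measurable_normc2.
  - by move=> x _; rewrite -EFinM lee_fin normc_realM ler_wpM2r// normc2_ge0.
by rewrite lte_mul_pinfty.
Qed.

(** Since [h] is in $L^2$, any function equal to it almost everywhere, such as the product of [g]
    and [f], is square integrable once measurable. *)
Lemma mul_operatorP g f h : measurable_fun setT g ->
  mul_operator mu (fun x => (g x)%:C%C) (f, h) <->
  {ae mu, forall x, h x = (g x)%:C%C * f x}.
Proof.
move=> mg; split=> [[]//|hE]; split => //=.
have [mfRe mfIm _] := L2_square_integrable f.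
have [mhRe mhIm h2] := L2_square_integrable h.
have [mgRe mgIm] := measurable_realM _ _ mg mfRe mfIm.
split => //; move: h2; congr (_ < _)%E; apply: ae_eq_integral => //.
- exact: measurable_normc2.
- exact: measurable_normc2.
- by apply: filterS hE => x -> _.
Qed.

Lemma measurable_inv s : measurable_fun setT s -> (forall x, 0 <= s x) ->
  measurable_fun setT (fun x => (s x)^-1).
Proof.
move=> ms s0.
(* The two functions agree also at the zeros of [s], where both the inverse and the power take the
   value 0. *)
rewrite (_ : (fun _ => _) = (fun x => s x `^ (-1))).
  exact: (measurableT_comp (f := (@powR R)^~ (-1)) (measurable_powR _) ms).
by apply/funext => x; rewrite powR_inv1.
Qed.

Lemma ae_inv_gt0 s :
  {ae mu, forall x, 0 < s x} -> {ae mu, forall x, 0 < (s x)^-1}.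
Proof. by apply: filterS => x; rewrite invr_gt0. Qed.

Lemma mul_operator_inv s f h : measurable_fun setT s -> (forall x, 0 <= s x) ->
  {ae mu, forall x, 0 < s x} ->
  mul_operator mu (fun x => (s x)%:C%C) (f, h) ->
  mul_operator mu (fun x => ((s x)^-1)%:C%C) (h, f).
Proof.
move=> ms s0 sp /mul_operatorP -/(_ ms) hE.
apply/mul_operatorP; first exact: measurable_inv.
apply: filterS2 sp hE => x sx ->.
rewrite mulrA -rmorphM /= mulVf ?mul1r//.
exact: lt0r_neq0.
Qed.

Lemma mul_operator_linear g : measurable_fun setT g ->
  linear_operator (mul_operator mu (fun x => (g x)%:C%C)).
Proof.
move=> mg; split.
- move=> f h h' /mul_operatorP -/(_ mg) hE /mul_operatorP -/(_ mg) h'E.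
  by apply/L2P; apply: filterS2 hE h'E => x -> ->.
- apply/mul_operatorP => //.
  have := L2ZE 0 (0 : L2 mu); apply: filterS => x.
  by rewrite scale0r mul0r => ->; rewrite mulr0.
- move=> a f h f' h' /mul_operatorP -/(_ mg) hE /mul_operatorP -/(_ mg) h'E.
  apply/mul_operatorP => //.
  apply: filterS (filterI (filterI (L2DE (a *: h) h') (L2DE (a *: f) f'))
    (filterI (filterI (L2ZE a h) (L2ZE a f)) (filterI hE h'E))).
  move=> x [[/= -> ->] [[-> ->] [-> ->]]].
  by rewrite mulrDr mulrCA.
Qed.

Lemma L2_inner_self f :
  inner f f = ((\int[mu]_x (Normc.normc (f x) ^+ 2))%R)%:C%C.
Proof.
change (inner f f) with (L2dot f f); rewrite /L2dot /L2form /cintegral.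
congr (_ +i* _)%C.
  apply: eq_Rintegral => x _; rewrite Defs.sqr_normc.
  by case: (f x) => a b /=; rewrite mulrN opprK !expr2.
rewrite -[RHS](_ : \int[mu]_(x in [set: T]) (0 : R) = 0)%R.
  apply: eq_Rintegral => x _.
  by case: (f x) => a b /=; rewrite mulrN mulrC addNr.
by rewrite /Rintegral integral0.
Qed.

Lemma closure_ran_mul_operator s z : measurable_fun setT s ->
  (forall x, 0 <= s x) -> {ae mu, forall x, 0 < s x} ->
  closure (ran (mul_operator mu (fun x => (s x)%:C%C))) z.
Proof.
move=> ms s0 sp.
pose E n := [set x | n.+1%:R^-1 <= s x].
have mE n : measurable (E n).
  by rewrite -[E n]setTI; exact: measurable_fun_le.
have [mRe mIm z2] := L2_square_integrable z.
have mz := measurable_normc2 _ mRe mIm.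
(* [k n] is the squared modulus of [z] off [E n], so its integral is the squared distance from [z]
   to its truncation to [E n]. *)
pose k n x := ((1 - \1_(E n) x) * Normc.normc (z x) ^+ 2)%:E.
have mk n : measurable_fun setT (k n).
  apply/measurable_EFinP/measurable_funM; last exact/measurable_EFinP.
  by apply: measurable_funB => //; exact: measurable_indic.
have k_le n x : (0 <= k n x <= (Normc.normc (z x) ^+ 2)%:E)%E.
  rewrite /k !lee_fin indicE; case: (_ \in _) => /=.
    by rewrite subrr mul0r lexx normc2_ge0.
  by rewrite subr0 mul1r lexx normc2_ge0.
have [_ _] : [/\ mu.-integrable setT (cst 0%E),
    (\int[mu]_x (`|k n x - cst 0 x|))%E @[n --> \oo] --> 0%E
  & (\int[mu]_x k n x)%E @[n --> \oo] --> (\int[mu]_x cst 0 x)%E].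
  apply: (dominated_convergence measurableT mk _ _
    (g := fun x => (Normc.normc (z x) ^+ 2)%:E)) => //.
  (* If [s x] is positive then [x] lies in [E n] for all large [n], so [k n x] is eventually 0. *)
  - apply: filterS sp => x sx _; apply: (@cvg_near_cst _ _ _ _ \oo).
    have [e] := near_infty_natSinv_lt (PosNum sx).
    move=> e0 eP; exists e => // n /eP /ltW sn.
    by rewrite /k indicE mem_set// subrr mul0r.
  - apply/integrableP; split => //.
    by under eq_integral do rewrite gee0_abs ?lee_fin ?normc2_ge0//.
  - apply: aeW => x n _; have /andP[k0 kz] := k_le n x.
    by rewrite gee0_abs.
rewrite integral0 => kcvg.
apply/closure_normP => e e0.
have re0 : 0 < complex.Re e by move: e0; rewrite ltcE => /andP[].
(* Positivity in [R[i]] forces the imaginary part to vanish. *)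
have eE : e = (complex.Re e)%:C%C.
  by move: e0; rewrite ltcE /= => /andP[/eqP]; case: (e) => a b /= ->.
have re2 : 0 < (complex.Re e) ^+ 2 by rewrite exprn_gt0.
have [N _ /(_ N (leqnn N))] : \forall n \near \oo,
    (\int[mu]_x k n x < (complex.Re e ^+ 2)%:E)%E.
  have re2E : (0%E < (complex.Re e ^+ 2)%:E)%E by rewrite lte_fin.
  exact: kcvg (open_ereal_lt' re2E).
move=> kN.
have mi : measurable_fun setT (\1_(E N) : T -> R) by exact: measurable_indic.
have [h hE] : exists h, {ae mu, forall x, h x = (\1_(E N) x)%:C%C * z x}.
  apply: (bounded_mul_rep _ 1 z mi) => x.
  by rewrite indicE; case: (_ \in _); rewrite ?expr1n ?expr0n.
(* [f] is the preimage of the truncation [h]; on [E N] the factor [1/s] is at most [N + 1], which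
   keeps [f] in $L^2$. *)
have [f fE] : exists f, {ae mu, forall x,
    f x = ((s x)^-1 * \1_(E N) x)%:C%C * z x}.
  apply: (@bounded_mul_rep _ (N.+1%:R ^+ 2)).
    by apply: measurable_funM => //; exact: measurable_inv.
  move=> x; rewrite indicE; case: (asboolP (E N x)) => [Ex|nEx].
    rewrite mem_set// mulr1 ler_sqr ?nnegrE ?invr_ge0//.
    rewrite -[leRHS]invrK lef_pV2// ?posrE ?invr_gt0//.
    exact: lt_le_trans Ex.
  by rewrite memNset// mulr0 expr0n sqr_ge0.
exists h.
  exists f; apply/mul_operatorP => //.
  apply: filterS (filterI sp (filterI hE fE)) => x [sx [/= -> ->]].
  by rewrite mulrA -rmorphM /= mulrA divff ?mul1r// lt0r_neq0.
rewrite -ltr_sqr ?nnegrE ?(ltW e0)// -inner_norm L2_inner_self eE -rmorphXn /=.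
rewrite ltcR -lte_fin.
have [mdRe mdIm d2] := L2_square_integrable (z - h).
rewrite fineK; last first.
  by rewrite ge0_fin_numE// integral_ge0// => x _; rewrite lee_fin normc2_ge0.
rewrite (_ : (\int[mu]_x _ = \int[mu]_x k N x)%E)//.
apply: ae_eq_integral => //; first exact: measurable_normc2.
have NE := L2ZE (-1) h; rewrite scaleN1r in NE.
apply: filterS (filterI (L2DE z (- h)) (filterI NE hE)) => x [/= -> [-> ->]] _.
rewrite /k indicE; case: (_ \in _) => /=.
  by rewrite subrr !mul1r mulN1r subrr Defs.sqr_normc/= expr0n addr0 mul0r.
by rewrite subr0 mul1r mul0r mulr0 addr0.
Qed.
End multiplication_operator.

(** * Adjoints of everywhere defined linear maps, as relations *)

Section adjoint.
Context (R : realType) (H K : innerProductSpaceType R).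
Context (f : {linear H -> K}).

Lemma adjoint_graphP y x :
  adjoint (graph f) (y, x) <-> forall z, inner (f z) y = inner z x.
Proof. by split=> [h z|h z w]; [exact: h|rewrite /graph /= => ->]. Qed.

Lemma adjoint_graph_linear : linear_operator (adjoint (graph f)).
Proof.
split.
- move=> y x x' /adjoint_graphP h /adjoint_graphP h'.
  by apply: inner_inj => z; rewrite -h h'.
- by apply/adjoint_graphP => z; rewrite !inner0r.
- move=> a y x y' x' /adjoint_graphP h /adjoint_graphP h'.
  by apply/adjoint_graphP => z; rewrite !innerDr !innerZr h h'.
Qed.

Lemma adjoint_isometry : linear_isometry f ->
  forall x, adjoint (graph f) (f x, x).
Proof. by move=> fiso x; apply/adjoint_graphP => z; exact: inner_isometry. Qed.

End adjoint.

(** * The operators $UT_sV^*$ and $VT_{1/s}U^*$ *)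

Section svd_operator.
Context (R : realType) (H K : hilbertType R) (M : ptopologicalType)
  (mu : {sigma_finite_measure set (borelType M) -> \bar R}).
Context (U : {linear L2 mu -> K}) (s : M -> R) (V : {linear L2 mu -> H}).
Hypotheses (Uiso : linear_isometry U) (Viso : linear_isometry V).
Hypothesis ms : measurable_fun setT (s : borelType M -> R).
Hypotheses (s_ge0 : forall x, 0 <= s x) (s_gt0 : {ae mu, forall x, 0 < s x}).

Let S := svd_operator U s V.
Let S' := svd_operator V (fun x => (s x)^-1) U.
Let Ts := mul_operator mu (fun x => (s x)%:C%C).

Let Ts_inv f h :
  Ts (f, h) <-> mul_operator mu (fun x => ((s x)^-1)%:C%C) (h, f).
Proof.
split=> [|hf]; first exact: mul_operator_inv.
have := @mul_operator_inv _ _ _ mu (fun x => (s x)^-1) h f.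
under [X in mul_operator mu X (f, h)]eq_fun do rewrite invrK.
apply => //; first exact: measurable_inv.
  by move=> x; rewrite invr_ge0.
exact: ae_inv_gt0.
Qed.

Let SP x y : S (x, y) <->
  exists f h, [/\ adjoint (graph V) (x, f), Ts (f, h) & y = U h].
Proof.
split=> [[h [f xf fh] yE]|[f [h [xf fh yE]]]]; first by exists f, h.
by exists h => //; exists f.
Qed.

(** Stated with [Ts] rather than its inverse, so that [S] and [S'] are described by the same pairs
    [(f, h)]. *)
Let S'P y x : S' (y, x) <->
  exists f h, [/\ adjoint (graph U) (y, h), Ts (f, h) & x = V f].
Proof.
split=> [[f [h yh hf] xE]|[f [h [yh fh xE]]]].
  by exists f, h; split => //; exact/Ts_inv.
by exists f => //; exists h => //; exact/Ts_inv.
Qed.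

Lemma svd_operator_linear : linear_operator S.
Proof.
have [Tfun T0 Tlin] := mul_operator_linear _ _ _ mu _ ms.
have [Vfun V0 Vlin] := adjoint_graph_linear _ _ _ V.
split.
- move=> x y y' /SP[f [h [xf fh ->]]] /SP[f' [h' [xf' fh' ->]]].
  by rewrite (Vfun _ _ _ xf' xf) in fh'; rewrite (Tfun _ _ _ fh' fh).
- by apply/SP; exists 0, 0; rewrite linear0.
- move=> a x y x' y' /SP[f [h [xf fh ->]]] /SP[f' [h' [xf' fh' ->]]].
  apply/SP; exists (a *: f + f'), (a *: h + h'); split.
  + exact: Vlin.
  + exact: Tlin.
  + by rewrite linearP.
Qed.

(** The isometry [U] transports the density of the range of $T_s$; a vector [U k] with [k] the image
    of [f] is the value of [S] at [V f], because $V^*V = 1$. *)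
Lemma range_sub_closure_ran_svd : range U `<=` closure (ran S).
Proof.
move=> _ [h _ <-]; apply/closure_normP => e e0.
have /closure_normP/(_ e e0)[k [f fk] hk] :=
  closure_ran_mul_operator _ _ _ mu s h ms s_ge0 s_gt0.
exists (U k); last by rewrite -linearB Uiso.
exists (V f); apply/SP; exists f, k; split => //.
exact: adjoint_isometry.
Qed.

Lemma orthocomplement_ran_svd y :
  orthocomplement (ran S) y <-> adjoint (graph U) (y, 0).
Proof.
split=> [oy|/adjoint_graphP yU z [x /SP[f [h [_ _ ->]]]]].
  apply/adjoint_graphP => z; rewrite inner0r innerC.
  rewrite (orthocomplement_closure _ _ _ _ oy) ?rmorph0//.
  by apply: range_sub_closure_ran_svd; exists z.
by rewrite innerC yU inner0r rmorph0.
Qed.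

(** The witness is $y' = UU^*y$. Since $U^*U = 1$, the remainder [y - y'] is killed by $U^*$, hence
    orthogonal to the range of [S]. *)
Lemma svd_composeP y x : S' (y, x) ->
  exists y', [/\ S (x, y'), ran S y' & orthocomplement (ran S) (y - y')].
Proof.
move=> /S'P[f [h [yh fh xE]]]; exists (U h).
have SVU : S (x, U h).
  apply/SP; exists f, h; split => //; rewrite xE; exact: adjoint_isometry.
split => //; first by exists x.
apply/orthocomplement_ran_svd/adjoint_graphP => z; move/adjoint_graphP in yh.
by rewrite innerBr yh inner_isometry// subrr inner0r.
Qed.

Lemma dom_svd_inverse : dom S' =
  [set y | exists y1 y2,
    [/\ ran S y1, orthocomplement (ran S) y2 & y = y1 + y2]].
Proof.
apply/seteqP; split=> [y [x /svd_composeP[y' [_ ry' oy]]]|].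
  by exists y', (y - y'); rewrite subrKC.
move=> _ [y1 [y2 [[x /SP[f [h [xf fh ->]]]] /orthocomplement_ran_svd oy ->]]].
(* $U^*$ sends [U h + y2] to [h], which lies in the range of $T_s$. *)
exists (V f); apply/S'P; exists f, h; split => //.
have [_ _ Ulin] := adjoint_graph_linear _ _ _ U.
have := Ulin 1 _ _ _ _ (adjoint_isometry _ _ _ U Uiso h) oy.
by rewrite !scale1r addr0.
Qed.

(** [V] is injective and $T_s$ sends 0 only to 0, so $VT_{1/s}U^*y = 0$ forces $U^*y = 0$. *)
Lemma ker_svd_inverse : ker S' = orthocomplement (ran S).
Proof.
have [Tfun T0 _] := mul_operator_linear _ _ _ mu _ ms.
apply/seteqP; split=> [y /S'P[f [h [yh fh /esym]]]|y oy].
  move=> /eqP; rewrite -normr_eq0 Viso normr_eq0 => /eqP f0.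
  rewrite f0 in fh; rewrite (Tfun _ _ _ fh T0) in yh.
  exact/orthocomplement_ran_svd.
apply/S'P; exists 0, 0; split => //; last by rewrite linear0.
exact/orthocomplement_ran_svd.
Qed.

(** [svd_composeP] provides a value of the composite that is a projection of [y]; one inclusion
    follows as [S] is single valued, the other as projections are unique. *)
Lemma svd_compose_inverse :
  (S \; S')%relation = restriction (orthoproj (closure (ran S))) (dom S').
Proof.
have [Sfun _ _] := svd_operator_linear.
apply/seteqP; split=> [[y p] /= [x yx xp]|[y p] [/= yp [[x yx] _]]].
  have [y' [xy' ry' oy']] := svd_composeP _ _ yx.
  rewrite (Sfun _ _ _ xp xy'); split => //=; last by split => //; exists x.
  by split; [exact: subset_closure|exact: orthocomplement_closure].
have [y' [xy' ry' oy']] := svd_composeP _ _ yx.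
exists x => //=; suff -> : p = y' by [].
apply: (orthoproj_uniq _ _ _ y) yp _.
by split; [exact: subset_closure|exact: orthocomplement_closure].
Qed.

End svd_operator.

Lemma svd_Moore_Penrose (R : realType) (H K : hilbertType R)
    (M : ptopologicalType)
    (mu : {sigma_finite_measure set (borelType M) -> \bar R})
    (U : {linear L2 mu -> K}) (s : M -> R) (V : {linear L2 mu -> H}) :
  linear_isometry U -> linear_isometry V ->
  measurable_fun setT (s : borelType M -> R) ->
  (forall x, 0 <= s x) -> {ae mu, forall x, 0 < s x} ->
  Moore_Penrose_inverse (svd_operator U s V)
    (svd_operator V (fun x => (s x)^-1) U).
Proof.
move=> Uiso Viso ms s0 sp.
have ms' : measurable_fun setT ((fun x => (s x)^-1) : borelType M -> R).
  exact: measurable_inv.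
have s0' x : 0 <= (s x)^-1 by rewrite invr_ge0.
have sp' : {ae mu, forall x, 0 < (s x)^-1} by exact: ae_inv_gt0.
split.
- exact: svd_operator_linear.
- exact: dom_svd_inverse.
- move=> x [y yx].
  have [y' [xy' _ _]] :=
    svd_composeP _ _ _ _ _ _ _ _ Uiso Viso ms s0 sp _ _ yx.
  by exists y'.
- exact: ker_svd_inverse.
- exact: svd_compose_inverse.
(* The previous identity with [U] and [V] exchanged and [1/s] for [s]; inverting twice restores [s],
   even at its zeros. *)
- have :=
    svd_compose_inverse _ _ _ _ mu V (fun x => (s x)^-1) U Viso Uiso ms' s0' sp'.
  by under [X in svd_operator U X V]eq_fun do rewrite invrK.
Qed.

(** [svd_eq] gives one inclusion of graphs; it is an equality because the domains agree and the
    larger graph is single valued. *)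
Lemma condensed_svdE (R : realType) (H K : hilbertType R)
    (M : ptopologicalType)
    (mu : {sigma_finite_measure set (borelType M) -> \bar R})
    (A : set (H * K)) (U : {linear L2 mu -> K}) (s : M -> R)
    (V : {linear L2 mu -> H}) :
  condensed_svd A U s V -> A = svd_operator U s V.
Proof.
move=> [_ _ ms _ _ domA AS]; apply/seteqP; split=> [[x y]|[x y] Sxy].
  exact: AS.
have [Sfun _ _] := svd_operator_linear _ _ _ _ mu U s V ms.
have [y' Axy'] : dom A x.
  by rewrite domA; case: Sxy => h [f xf fh] _; exists f => //; exists h.
by rewrite (Sfun _ _ _ Sxy (AS _ _ Axy')).
Qed.

(** * Uniqueness of the Moore-Penrose inverse *)

Section uniqueness.
Context (R : realType) (H K : hilbertType R) (A : set (H * K)).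
Hypothesis A_linear : linear_operator A.

(** For [x] in the kernel, [B] after [A] sends [x] to 0, so 0 is the projection of [x] onto the
    closure of the range of [B]. *)
Lemma Moore_Penrose_ker_orthogonal B : Moore_Penrose_inverse A B ->
  forall x, ker A x -> orthocomplement (ran B) x.
Proof.
move=> [[_ B0 _] _ _ _ _ BA] x Ax z Bz.
have : (B \; A)%relation (x, 0) by exists 0.
rewrite BA => -[[_ /= xB] _].
by rewrite subr0 in xB; apply: xB; exact: subset_closure.
Qed.

Lemma Moore_Penrose_inverse_sub B B' :
  Moore_Penrose_inverse A B -> Moore_Penrose_inverse A B' -> B `<=` B'.
Proof.
move=> BP B'P [y x] Byx.
have [Bfun _ _] := MP_linear BP.
have [_ A0 Alin] := A_linear.
have domE : dom B = dom B' by rewrite (MP_dom BP) (MP_dom B'P).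
have [x' B'yx'] : dom B' y by rewrite -domE; exists x.
have [w Axw] : dom A x by apply: (MP_ran BP); exists y.
have [w' Axw'] : dom A x' by apply: (MP_ran B'P); exists y.
have AB : (A \; B)%relation (y, w) by exists x.
have AB' : (A \; B')%relation (y, w') by exists x'.
rewrite (MP_mulr BP) in AB; rewrite (MP_mulr B'P) in AB'.
(* [w] and [w'] are both projections of [y] onto the closure of the range of [A], a set independent
   of [B] and [B']. *)
have ww' : w = w' by apply: (orthoproj_uniq _ _ _ y) AB.1 AB'.1.
have kx : ker A (x - x').
  have := Alin (-1) _ _ _ _ Axw' Axw.
  by rewrite !scaleN1r ww' addrC addNr addrC.
suff -> : x = x' by [].
(* [x - x'] is orthogonal to [x], in the range of [B], and to [x'], in the range of [B'], hence to
   itself. *)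
apply/eqP; rewrite -subr_eq0; apply/eqP/inner_eq0; rewrite innerBr.
rewrite (Moore_Penrose_ker_orthogonal _ BP _ kx); last by exists y.
rewrite (Moore_Penrose_ker_orthogonal _ B'P _ kx); last by exists y.
by rewrite subrr.
Qed.

Lemma Moore_Penrose_inverse_uniq B B' :
  Moore_Penrose_inverse A B -> Moore_Penrose_inverse A B' -> B = B'.
Proof.
by move=> BP B'P; apply/seteqP; split; exact: Moore_Penrose_inverse_sub.
Qed.

End uniqueness.

(** The equivalence expresses both that the given operator is a Moore-Penrose inverse (right to
    left) and that it is the only one (left to right). *)
Theorem proposition4p7 (R : realType) (H K : hilbertType R)
    (H_separable : separable H) (K_separable : separable K)
    (A : set (H * K)) (A_linear : linear_operator A) (A_closed : closed A)
    (A_dense : dense (dom A))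
    (M : ptopologicalType)
    (mu : {sigma_finite_measure set (borelType M) -> \bar R})
    (U : {linear L2 mu -> K}) (sigma : M -> R) (V : {linear L2 mu -> H})
    (A_svd : condensed_svd A U sigma V) :
  forall B : set (K * H),
    Moore_Penrose_inverse A B <->
    B = svd_operator V (fun x => (sigma x)^-1) U.
Proof.
have AE := condensed_svdE _ _ _ _ _ _ _ _ _ A_svd.
have [Uiso Viso ms s0 sp _ _] := A_svd.
have SP : Moore_Penrose_inverse A (svd_operator V (fun x => (sigma x)^-1) U).
  by rewrite AE; exact: svd_Moore_Penrose.
move=> B; split=> [BP|->//].
exact: (Moore_Penrose_inverse_uniq _ _ _ A A_linear).
Qed.
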